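(* In the edge-distinguishing game (EDGe) played on the cycle $C_5$ (with $\lambda(C_5)$ colors), Player 1 has a winning strategy.
   Context: $C_n$ is the cycle on $n$ vertices. For a positive integer $k$ let $[k]=\{1,\dots,k\}$. A $k$-coloring $c:V(G)\to[k]$ induces $c'(\{u,v\})=\{c(u),c(v)\}$ (a multiset); $c$ is edge-distinguishing if $c'$ is injective, and $\lambda(G)$ is the least $k$ admitting such a coloring. A partial coloring on $U\subseteq V(G)$ has partial induced edge coloring on $G[U]$. EDGe on $G$: two players, Player 1 first, alternately color an uncolored vertex with a color from $[\lambda(G)]$; a move is legal iff afterwards the partial induced edge coloring of the colored vertices is injective. The player making the last legal move wins. A winning strategy guarantees a win regardless of the opponent's play. *)

(* Defs.v *)
From mathcomp Require Import all_boot.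
From mathcomp Require Import finmap multiset.

Set Implicit Arguments.
Unset Strict Implicit.
Unset Printing Implicit Defensive.

Record sgraph := SGraph {
  vertex :> finType;
  adj : rel vertex;
  adj_sym : symmetric adj;
  adj_irrefl : irreflexive adj }.

Definition edges (G : sgraph) : {set {set G}} :=
  [set [set p.1; p.2] | p : G * G & adj p.1 p.2].

(* The usual cycle for n >= 3; the conjunct i != j only matters for n = 1,
   where it removes the loop. *)
Definition cycle_adj (n : nat) : rel 'I_n :=
  fun i j => (i != j) && ((i.+1 == j %[mod n]) || (j.+1 == i %[mod n])).

Lemma cycle_adj_sym n : symmetric (@cycle_adj n).
Proof. by move=> i j; rewrite /cycle_adj eq_sym orbC. Qed.

Lemma cycle_adj_irrefl n : irreflexive (@cycle_adj n).
Proof. by move=> i; rewrite /cycle_adj eqxx. Qed.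

Definition cycle_graph (n : nat) : sgraph :=
  SGraph (@cycle_adj_sym n) (@cycle_adj_irrefl n).

(* The k colours 1, ..., k are represented by 'I_k. *)
Definition induced_edge_coloring (G : sgraph) (k : nat)
    (c : {ffun G -> 'I_k}) (e : {set G}) : {mset 'I_k}%mset :=
  seq_mset [seq c v | v <- enum e].

Definition edge_distinguishing (G : sgraph) (k : nat)
    (c : {ffun G -> 'I_k}) : bool :=
  dinjectiveb (induced_edge_coloring c) (mem (edges G)).

Definition ed_colorable (G : sgraph) (k : nat) : bool :=
  (0 < k) && [exists c : {ffun G -> 'I_k}, edge_distinguishing c].

Lemma ed_colorable_ex (G : sgraph) : exists k, ed_colorable G k.
Proof.
exists #|G|.+1; rewrite /ed_colorable /=; apply/existsP.
pose c := [ffun v : G => widen_ord (leqnSn #|G|) (enum_rank v)].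
have c_inj : injective c.
  by move=> u v; rewrite !ffunE => /(congr1 val) /= /ord_inj /enum_rank_inj.
exists c; apply/dinjectiveP => e f _ _ /eq_seq_msetP/perm_mem ef.
by apply/setP => v; have := ef (c v); rewrite !mem_map // !mem_enum.
Qed.

Definition lambda (G : sgraph) : nat := ex_minn (ed_colorable_ex G).

Section Game.
Variables (G : sgraph) (k : nat).

(* None marks an uncoloured vertex. *)
Definition pcoloring := {ffun G -> option 'I_k}.

Definition colored (c : pcoloring) : {set G} := [set v | c v != None].

Definition induced_edges (U : {set G}) : {set {set G}} :=
  [set e in edges G | e \subset U].

Definition partial_induced_edge_coloring (c : pcoloring) (e : {set G}) :
  {mset 'I_k}%mset := seq_mset (pmap c (enum e)).

Definition partial_edge_distinguishing (c : pcoloring) : bool :=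
  dinjectiveb (partial_induced_edge_coloring c)
    (mem (induced_edges (colored c))).

Definition move := (G * 'I_k)%type.

Definition make_move (c : pcoloring) (m : move) : pcoloring :=
  [ffun v => if v == m.1 then Some m.2 else c v].

Definition legal (c : pcoloring) (m : move) : bool :=
  (m.1 \notin colored c) && partial_edge_distinguishing (make_move c m).

(* A play is the list of the moves made so far, oldest first. *)
Definition play := seq move.

Definition position (p : play) : pcoloring :=
  foldl make_move [ffun=> None] p.

Definition legal_play (p : play) : Prop :=
  forall q m r, p = rcons q m ++ r -> legal (position q) m.

Definition finished (p : play) : Prop :=
  forall m, ~~ legal (position p) m.

Inductive player := Player1 | Player2.

Definition player_to_move (p : play) : player :=
  if odd (size p) then Player2 else Player1.

Definition won_by (P : player) (p : play) : Prop :=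
  finished p /\ exists q m, p = rcons q m /\ player_to_move q = P.

Definition strategy := play -> move.

Definition follows (P : player) (s : strategy) (p : play) : Prop :=
  forall q m r, p = rcons q m ++ r -> player_to_move q = P -> m = s q.

(* Every play has at most #|G| moves, so a play in which P keeps following s
   does reach a finished position. *)
Definition winning_strategy (P : player) (s : strategy) : Prop :=
  forall p, legal_play p -> follows P s p ->
    (finished p -> won_by P p) /\
    (~ finished p -> player_to_move p = P -> legal (position p) (s p)).

End Game.

Definition EDGe_winning_strategy (G : sgraph) (P : player)
    (s : strategy G (lambda G)) : Prop :=
  winning_strategy P s.

(* Main.v *)
Require Import Defs.
From mathcomp Require Import all_boot.
From mathcomp Require Import finmap multiset.

(** Three colors are needed on [C_5], since two colors give only three multisets
    of size two, and three colors suffice. The game is then small enough to be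
    solved by exhaustive search. A position of the game on [C_n] is encoded as
    a function [nat -> option nat], on which legality is a comparison of the
    color pairs of consecutive vertices, and retrograde analysis of the encoded
    game is carried out by computation. *)

Set Implicit Arguments.
Unset Strict Implicit.
Unset Printing Implicit Defensive.

(** * Retrograde analysis on an arbitrary graph *)

Section GraphGame.
Variables (G : sgraph) (k : nat).
Implicit Types (c : pcoloring G k) (p : play G k).

(* Whoever moves at [c] loses, and makes at most [d] further moves. *)
Fixpoint loses (d : nat) c : bool :=
  [forall m, legal c m ==>
    if d is d'.+1 then
      [exists m', legal (make_move c m) m' &&
                  loses d' (make_move (make_move c m) m')]
    else false].

Lemma loses_reply d c m : loses d c -> legal c m ->
  exists2 m', legal (make_move c m) m' &
    (0 < d) && loses d.-1 (make_move (make_move c m) m').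
Proof.
case: d => [|d] /= /forallP/(_ m)/implyP lc /lc // /existsP[m' /andP[? ?]].
by exists m'.
Qed.

Lemma position_rcons p m : position (rcons p m) = make_move (position p) m.
Proof. by rewrite /position foldl_rcons. Qed.

Lemma legal_play_rcons p m :
  legal_play (rcons p m) -> legal_play p /\ legal (position p) m.
Proof.
move=> lp; split=> [q m' r e|]; last by apply: (lp p m [::]); rewrite cats0.
by apply: (lp q m' (rcons r m)); rewrite e rcons_cat.
Qed.

Lemma follows_rcons P s p m : follows P s (rcons p m) ->
  follows P s p /\ (player_to_move p = P -> m = s p).
Proof.
move=> fp; split=> [q m' r e|]; last by apply: (fp p m [::]); rewrite cats0.
by apply: (fp q m' (rcons r m)); rewrite e rcons_cat.
Qed.

(** The strategy always moves to a position from which the opponent loses. After each opponent's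
    move [loses] supplies such a reply, with the bound lowered by one per round. *)
Theorem winning_strategy_of_loses d m0 :
    legal [ffun=> None] m0 -> loses d (make_move [ffun=> None] m0) ->
  exists s : strategy G k, winning_strategy Player1 s.
Proof.
move=> legal0 loses0.
(* [(size p)./2] counts the completed rounds, each of which uses up one unit of [d]. *)
pose good p m := legal (position p) m &&
  loses (d - (size p)./2) (make_move (position p) m).
pose s p := odflt m0 [pick m | good p m].
have sP p m : good p m -> good p (s p).
  by rewrite /s; case: pickP => [//|/(_ m) -> //].
(* On plays that follow [s], a good move exists whenever Player 1 is to move, so the default [m0]
   does no harm. *)
have inv p : legal_play p -> follows Player1 s p ->
    if odd (size p) then loses (d - (size p)./2) (position p)
    else good p (s p).
  elim/last_ind: p => [|p m IH].
    by move=> _ _; apply: (sP _ m0); rewrite /good legal0 subn0.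
  move=> /legal_play_rcons[lp lm] /follows_rcons[fp mE]; move: {IH}(IH lp fp).
  rewrite size_rcons /= uphalf_half position_rcons.
  case: ifP => [odd_p|even_p] /=; last first.
    by move=> /andP[_]; rewrite -mE // /player_to_move even_p.
  move=> /loses_reply /(_ lm) [m' lm' /andP[d_gt0 lose']].
  apply: (sP _ m'); rewrite /good position_rcons lm' /=.
  by rewrite size_rcons /= uphalf_half odd_p addnC subnDA subn1.
exists s => p lp fp; have := inv p lp fp; rewrite /player_to_move.
(* After an odd number of moves Player 1 moved last; after an even number [s p] is legal, so the
   play is not finished. *)
case: ifP => [odd_p _|even_p /andP[legal_sp _]]; split=> // fin.
  split=> //; elim/last_ind: p odd_p {lp fp fin} => [//|q m _].
  rewrite size_rcons /= => /negbTE even_q; exists q, m; split=> //.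
  by rewrite /player_to_move even_q.
by have := fin (s p); rewrite legal_sp.
Qed.

(** Lets the encoded test for game positions also serve to compute [lambda]. *)
Lemma edge_distinguishing_partial (c : {ffun G -> 'I_k}) :
  edge_distinguishing c = partial_edge_distinguishing [ffun v => Some (c v)].
Proof.
set c' := [ffun v => Some (c v)].
have eqc e : partial_induced_edge_coloring c' e = induced_edge_coloring c e.
  rewrite /partial_induced_edge_coloring /induced_edge_coloring; congr seq_mset.
  by elim: (enum e) => //= v s <-; rewrite ffunE.
have eqe e : (e \in induced_edges (colored c')) = (e \in edges G).
  rewrite inE; case: (e \in edges G) => //=; apply/subsetP => v _.
  by rewrite inE ffunE.
apply/dinjectiveP/dinjectiveP => inj e f.
  by rewrite !eqc !eqe; apply: inj.
by move=> *; apply: inj; rewrite ?eqc ?eqe.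
Qed.

Lemma pair_partial_coloring c (u v : G) a b : u != v ->
    c u = Some a -> c v = Some b ->
  partial_induced_edge_coloring c [set u; v] = seq_mset [:: a; b].
Proof.
move=> uv cu cv; apply/eq_seq_msetP.
have -> : [:: a; b] = pmap c [:: u; v] by rewrite /= cu cv.
apply: perm_pmap; apply: uniq_perm; first exact: enum_uniq.
  by rewrite /= inE uv.
by move=> w; rewrite mem_enum !inE.
Qed.

End GraphGame.

(** * Edges of the cycle and the encoded test *)

Section Cycle.
Variable n : nat.
Hypothesis n_gt2 : 2 < n.

Lemma ordS_neq (i : 'I_n) : i != ordS i.
Proof.
rewrite -val_eqE /=; have := ltn_ord i; rewrite leq_eqVlt => /predU1P[iE|lt_i].
  by rewrite iE modnn; apply: contraTneq n_gt2 => i0; rewrite -iE i0.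
by rewrite modn_small // neq_ltn ltnSn.
Qed.

Lemma ordS2_neq (i : 'I_n) : i != ordS (ordS i).
Proof.
apply/eqP => /(congr1 val) /= e.
have /eqP : i + 2 = i + 0 %[mod n].
  by rewrite addn0 [RHS]modn_small // [RHS]e -(addn1 (_ %% _)) modnDml addn1 addn2.
by rewrite eqn_modDl modn_small // mod0n.
Qed.

Lemma cycle_edges : edges (cycle_graph n) = [set [set i; ordS i] | i : 'I_n].
Proof.
have ordSE (i j : 'I_n) : i.+1 = j %[mod n] -> j = ordS i.
  by move=> e; apply: val_inj; rewrite /= e modn_small.
apply/setP => e; apply/imsetP/imsetP => [[[i j]]|[i _ ->]].
  rewrite inE /= => /andP[_ /orP[]] /eqP/ordSE -> ->; first by exists i.
  by exists j => //; rewrite setUC.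
exists (i, ordS i) => //; rewrite inE /= /cycle_adj ordS_neq /=.
by rewrite modn_mod eqxx.
Qed.

(** Two different indices of one edge would be successors of each other, against [ordS2_neq]. Edges
    can thus be compared through their first vertices. *)
Lemma cycle_edge_inj : injective (fun i : 'I_n => [set i; ordS i]).
Proof.
move=> i j /setP e; have := e i; have := e (ordS i); rewrite !inE !eqxx orbT.
case: (i =P j) => //= _ /esym/orP[/eqP Si|/eqP/(bij_inj (@ordS_bij n))//].
by move=> /esym/eqP iE; have := ordS2_neq j; rewrite -iE Si eqxx.
Qed.

(** Here [i] and [j] name the edges that start at these vertices; [perm_eq] compares their color
    multisets, and an edge with an uncolored end imposes nothing. *)
Definition compatible (f : nat -> option nat) (i j : nat) : bool :=
  let i' := i.+1 %% n in let j' := j.+1 %% n in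
  [|| f i == None, f i' == None, f j == None, f j' == None, i == j
    | ~~ perm_eq [:: f i; f i'] [:: f j; f j']].

Definition distinguishing (f : nat -> option nat) : bool :=
  all (fun i => all (compatible f i) (iota 0 n)) (iota 0 n).

Lemma distinguishingP f :
  reflect (forall i j : 'I_n, compatible f i j) (distinguishing f).
Proof.
apply: (iffP allP) => [df i j|cf i].
  have mem_ord (v : 'I_n) : val v \in iota 0 n by rewrite mem_iota /=.
  exact: allP (df _ (mem_ord i)) _ (mem_ord j).
rewrite mem_iota /= add0n => lti; apply/allP => j.
by rewrite mem_iota /= add0n => ltj; apply: (cf (Ordinal lti) (Ordinal ltj)).
Qed.

(** * Correctness of the encoded game *)

Section Encoding.
Variable k : nat.
Implicit Type c : pcoloring (cycle_graph n) k.

Lemma cycle_edge_coloring c (i : 'I_n) a b :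
    c i = Some a -> c (ordS i) = Some b ->
  partial_induced_edge_coloring c [set i; ordS i] = seq_mset [:: a; b].
Proof.
exact: (@pair_partial_coloring (cycle_graph n) _ _ _ _ _ _ (ordS_neq i)).
Qed.

Definition encodes (f : nat -> option nat) c : Prop :=
  forall i : 'I_n, f i = omap val (c i).

Lemma distinguishing_encodes f c : encodes f c ->
  distinguishing f = partial_edge_distinguishing c.
Proof.
move=> fc.
have fS (i : 'I_n) : f (i.+1 %% n) = omap val (c (ordS i)) by rewrite -fc.
apply/distinguishingP/dinjectiveP => [cf e e'|inj i j].
  rewrite !inE cycle_edges => /andP[/imsetP[i _ ->] /subsetP si].
  move=> /andP[/imsetP[j _ ->] /subsetP sj].
  (* Both edges lie in the colored set, so all four ends carry colors. *)
  move: (si i) (si (ordS i)) (sj j) (sj (ordS j)); rewrite !inE !eqxx !orbT.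
  case ci: (c i) => [a|]; last by move=> /(_ isT).
  case ci': (c (ordS i)) => [a'|]; last by move=> _ /(_ isT).
  case cj: (c j) => [b|]; last by move=> _ _ /(_ isT).
  case cj': (c (ordS j)) => [b'|]; last by move=> _ _ _ /(_ isT).
  move=> _ _ _ _.
  rewrite (cycle_edge_coloring ci ci').
  rewrite (cycle_edge_coloring cj cj') => /eq_seq_msetP pab.
  have := cf i j; rewrite /compatible !fS !fc ci ci' cj cj' /=.
  case/orP=> [/eqP/val_inj -> //|/negP[]].
  exact: (perm_map (Some \o val) pab).
rewrite /compatible !fS !fc.
case ci: (c i) => [a|] //; case ci': (c (ordS i)) => [a'|] //.
case cj: (c j) => [b|] //; case cj': (c (ordS j)) => [b'|] //=.
have [//|neq_ij /=] := eqVneq (i : nat) j.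
apply: contraNN neq_ij => pab; apply/eqP; congr val.
have edgeU (v : 'I_n) x x' : c v = Some x -> c (ordS v) = Some x' ->
    [set v; ordS v] \in induced_edges (colored c).
  move=> cv cv'; rewrite inE cycle_edges; apply/andP; split; first exact: imset_f.
  by apply/subsetP => w /set2P[] ->; rewrite inE ?cv ?cv'.
apply: cycle_edge_inj; apply: inj (edgeU _ _ _ ci ci') (edgeU _ _ _ cj cj') _.
rewrite (cycle_edge_coloring ci ci').
rewrite (cycle_edge_coloring cj cj').
apply/eq_seq_msetP; apply: (@perm_map_inj _ _ (Some \o val)) => //.
by move=> x y [] /val_inj.
Qed.

Definition update (f : nat -> option nat) (m : nat * nat) : nat -> option nat :=
  fun i => if i == m.1 then Some m.2 else f i.

Definition legal_code (f : nat -> option nat) (m : nat * nat) : bool :=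
  if f m.1 == None then distinguishing (update f m) else false.

Definition move_code (m : move (cycle_graph n) k) : nat * nat :=
  (val (m.1 : 'I_n), val m.2).

Lemma update_encodes f c m : encodes f c ->
  encodes (update f (move_code m)) (make_move c m).
Proof. by move=> fc i; rewrite /update ffunE fc val_eqE; case: ifP. Qed.

Lemma legal_encodes f c m : encodes f c ->
  legal_code f (move_code m) = legal c m.
Proof.
move=> fc; rewrite /legal_code /legal.
rewrite (distinguishing_encodes (update_encodes m fc)).
by rewrite inE negbK fc; case: (c m.1).
Qed.

Definition move_codes : seq (nat * nat) :=
  [seq (i, a) | i <- iota 0 n, a <- iota 0 k].

Lemma move_codesP x :
  reflect (exists m, x = move_code m) (x \in move_codes).
Proof.
apply: (iffP allpairsP) => [[[i a] /= []]|[[i a] ->]].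
  rewrite !mem_iota /= !add0n => lti lta ->.
  by exists (Ordinal lti : cycle_graph n, Ordinal lta).
by exists (move_code (i, a)); rewrite !mem_iota /= !add0n !ltn_ord.
Qed.

(* Call-by-value evaluation of [&&] and [==>] would explore the illegal moves,
   hence the conditionals. *)
Fixpoint loses_code (d : nat) (f : nat -> option nat) : bool :=
  all (fun m => if legal_code f m then
    if d is d'.+1 then
      has (fun m' => if legal_code (update f m) m'
                     then loses_code d' (update (update f m) m') else false)
        move_codes
    else false else true) move_codes.

(** By [move_codesP] the list searched consists exactly of the codes of moves, so both quantifiers
    carry over. *)
Lemma loses_encodes d f c : encodes f c -> loses_code d f -> loses d c.
Proof.
elim: d f c => [|d IH] f c fc /= /allP lf; apply/forallP => m;
  have mI : move_code m \in move_codes by [apply/move_codesP; exists m];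
  have := lf _ mI; rewrite (legal_encodes m fc) //.
case: (legal c m) => //= /hasP[_ /move_codesP[m' ->]].
have fc' := update_encodes m fc; rewrite (legal_encodes m' fc').
case: ifP => // l' w; apply/existsP; exists m'.
by rewrite l' (IH _ _ (update_encodes m' fc') w).
Qed.

End Encoding.

End Cycle.

(** * The cycle on five vertices *)

Definition aabbc (i : nat) : nat := nth 0 [:: 0; 0; 1; 1; 2] i.

Lemma lambda_cycle5 : lambda (cycle_graph 5) = 3.
Proof.
rewrite /lambda; case: ex_minnP => k /andP[_ /existsP[c]].
rewrite edge_distinguishing_partial => dc min_k.
apply/eqP; rewrite eqn_leq; apply/andP; split.
  apply: min_k; apply/andP; split=> //; apply/existsP.
  (* Around the cycle the color pairs are 00, 01, 11, 12, 20, all different. *)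
  exists [ffun i : 'I_5 => inord (aabbc i)]; rewrite edge_distinguishing_partial.
  rewrite -(@distinguishing_encodes 5 _ _ (fun i => Some (aabbc i))) // => i.
  by rewrite !ffunE /= inordK //; case: i => [[|[|[|[|[|]]]]]].
rewrite leqNgt; apply/negP => k_lt3; move: dc.
pose s := [seq val (c i) | i <- [:: inord 0; inord 1; inord 2; inord 3; inord 4]].
have enc : encodes (fun i => Some (nth 0 s i)) [ffun v => Some (c v)].
  move=> i; rewrite ffunE /=; congr Some; rewrite -[in RHS](inord_val i).
  by case: i => [[|[|[|[|[|]]]]]].
rewrite -(distinguishing_encodes _ enc) // {enc}/s /=.
(* With fewer than three colors each value is a boolean, which leaves 32 closed cases to compute. *)
have cE v : exists b : bool, val (c v) = b.
  have : val (c v) < 2 by apply: leq_trans (ltn_ord _) _.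
  by case: (val (c v)) => [|[|]] // _; [exists false | exists true].
have [[b0 ->] [b1 ->]] := (cE (inord 0), cE (inord 1)).
have [[b2 ->] [b3 ->]] := (cE (inord 2), cE (inord 3)).
have [b4 ->] := cE (inord 4).
by case: b0 b1 b2 b3 b4 => [] [] [] [] []; vm_compute.
Qed.

Theorem theorem3p14 :
  exists s : strategy (cycle_graph 5) (lambda (cycle_graph 5)),
    EDGe_winning_strategy Player1 s.
Proof.
rewrite /EDGe_winning_strategy lambda_cycle5.
have enc0 : @encodes 5 3 (fun=> None) [ffun=> None] by move=> i; rewrite ffunE.
(* Up to rotation and renaming of colors this is the only opening move. *)
pose m : move (cycle_graph 5) 3 := (@Ordinal 5 0 isT, @Ordinal 3 0 isT).
(* Four vertices remain after the opening, so Player 2 makes at most two moves. *)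
apply: (@winning_strategy_of_loses _ _ 2 m).
  by rewrite -(legal_encodes _ m enc0) //; vm_compute.
by apply: (loses_encodes _ (update_encodes m enc0)) => //; vm_compute.
Qed.
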